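(* Let $p\ge 2$ be an integer. There exists a ReLU neural network with $$p+\left\lceil \log_2 \binom{p-2}{\lfloor \frac{p-2}{2}\rfloor}\right\rceil$$ hidden layers, taking as input $\Delta^0=\{f^k_{i+j}\}_{j=-p+1}^{p-2}\in\mathbb{R}^{2p-2}$ and with output $\hat Y\in\mathbb{R}^{p-1}$, such that for every input $\Delta^0$ the stencil shift $\min\operatorname{arg\,max}_{1\le j\le p-1}\hat Y_j-1$ obtained from the network output is exactly the stencil shift $r\in\{0,\dots,p-2\}$ returned by the ENO-$p$ interpolation stencil selection algorithm on $\Delta^0$.
   Context: **ReLU neural networks.** A ReLU neural network of depth $L$ with input dimension $n_0=m$ and output dimension $n_L=n$ is a map $Z^0\mapsto Z^L$ of the form $Z^l=\mathcal{A}^l(W^lZ^{l-1}+b^l)$, $1\le l\le L$, with weights $W^l\in\mathbb{R}^{n_l\times n_{l-1}}$ and biases $b^l\in\mathbb{R}^{n_l}$, where $\mathcal{A}^l(Z)=(Z)_+=\max(0,Z)$ componentwise for $1\le l\le L-1$ and $\mathcal{A}^L(Z)=Z$. Such a network has $L-1$ hidden layers. In classification problems with classes indexed by $j$, the class predicted from the output $\hat Y$ is by default $\min\operatorname{arg\,max}_j\hat Y_j$, i.e. the smallest index at which the maximum is attained; here class $j$ corresponds to stencil shift $j-1$. **ENO-$p$ interpolation stencil selection.** The numbers $f^k_{i+j}$, $-p+1\le j\le p-2$, are the values (including possibly prescribed ghost values) of a function at consecutive nodes of a uniform grid around the interval $[x^k_{i-1},x^k_i]$; the algorithm depends only on these $2p-2$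 real numbers. Write the input as an array with entries $\Delta^0[1],\dots,\Delta^0[2p-2]$, where $\Delta^0[1]=f^k_{i-p+1}$ and $\Delta^0[2p-2]=f^k_{i+p-2}$. The algorithm is: 1. (Undivided differences) For $j=1,\dots,p-1$ set $\Delta^j[m]=\Delta^{j-1}[m+1]-\Delta^{j-1}[m]$ for $1\le m\le 2p-2-j$. 2. Set $r=0$. For $j=2,\dots,p-1$ in order: if $|\Delta^j[p-2-r]|<|\Delta^j[p-1-r]|$, replace $r$ by $r+1$. 3. Return $r$. *)

(* Defs.v *)
From mathcomp Require Import all_boot all_order all_algebra.
From mathcomp Require Import reals.

Set Implicit Arguments.
Unset Strict Implicit.
Unset Printing Implicit Defensive.

Import Order.TTheory GRing.Theory Num.Theory.
Local Open Scope ring_scope.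

(** * ReLU neural networks *)

Definition relu (R : realType) (x : R) : R := Num.max 0 x.

(** [relu_network R n h m]: networks with input dimension [m], output dimension
    [n] and [h] hidden layers, i.e. of depth [L = h + 1].  The outermost
    constructor is the layer closest to the input; the widths of the hidden
    layers are the arguments [k] of [HiddenLayer]. *)
Inductive relu_network (R : realType) (n : nat) : nat -> nat -> Type :=
| OutputLayer (m : nat) (W : 'M[R]_(n, m)) (b : 'cV[R]_n) :
    relu_network R n 0 m
| HiddenLayer (h m k : nat) (W : 'M[R]_(k, m)) (b : 'cV[R]_k)
    (N : relu_network R n h k) :
    relu_network R n h.+1 m.

Fixpoint network_map (R : realType) (n h m : nat) (N : relu_network R n h m) :
    'cV[R]_m -> 'cV[R]_n :=
  match N with
  | OutputLayer _ W b => fun Z => W *m Z + b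
  | HiddenLayer _ _ _ W b N' =>
      fun Z => network_map N' (map_mx (@relu R) (W *m Z + b))
  end.

(** Classes are numbered from 1, hence the successor.  For [n = 0] there is no
    class and the value is meaningless. *)
Definition min_argmax (R : realType) (n : nat) (Y : 'cV[R]_n) : nat :=
  (find (fun j : 'I_n => [forall k : 'I_n, Y k 0 <= Y j 0]) (enum 'I_n)).+1.

(** * ENO-p interpolation stencil selection *)

(** [undivided_difference f j m] is the array entry Delta^j[m], with [m]
    numbered from 1; thus Delta^0[m] is the coordinate of [f] of (0-based) index
    [m - 1].  Entries outside 1 <= m <= 2p - 2 - j are irrelevant: the
    algorithm below never reads them, since [r <= j - 2] before step [j]. *)
Fixpoint undivided_difference (R : realType) (p : nat)
    (f : 'cV[R]_(2 * p - 2)) (j m : nat) : R :=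
  if j is j'.+1 then
    undivided_difference f j' m.+1 - undivided_difference f j' m
  else oapp (fun i : 'I_(2 * p - 2) => f i 0) 0 (insub (m - 1)%N).

Definition eno_step (R : realType) (p : nat) (f : 'cV[R]_(2 * p - 2))
    (r j : nat) : nat :=
  if `|undivided_difference f j (p - 2 - r)|
       < `|undivided_difference f j (p - 1 - r)|
  then r.+1 else r.

Definition eno_stencil_shift (R : realType) (p : nat)
    (f : 'cV[R]_(2 * p - 2)) : nat :=
  foldl (eno_step f) 0%N (index_iota 2 p).

(* Main.v *)
Require Import Defs.
From mathcomp Require Import all_boot all_order all_algebra.
From mathcomp Require Import boolp reals.
From mathcomp Require Import lra.

(** The shift returned by the algorithm is computed by dynamic programming.  With
    [d] the difference of the two absolute values compared at a step in state
    [r], moving to [r + 1] costs [(- d)_+] and staying at [r] costs [(d)_+].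
    The cheapest way to reach the state actually chosen is free.  Every smaller
    state has positive cost, because the algorithm moves up only on a strict
    comparison [d > 0]; ties can make only larger states free.  Hence the smallest index
    maximizing the negated costs is the ENO shift.  Absolute values and
    penalties take one hidden layer each, and each of the [p - 2] steps takes one
    more, since [min(a, b) = a - (a - b)_+].  The remaining layers can be filled
    with [x = (x)_+ - (- x)_+]. *)

Set Implicit Arguments.
Unset Strict Implicit.
Unset Printing Implicit Defensive.

Import Order.TTheory GRing.Theory Num.Theory.
Local Open Scope ring_scope.

(** * Identities for the ReLU *)

Section Relu.
Variable R : realType.
Implicit Types x y : R.

Lemma relu_ge0 x : 0 <= relu x.
Proof. by rewrite /relu le_max lexx. Qed.

Lemma relu_gt0 x : (0 < relu x) = (0 < x).
Proof. by rewrite /relu lt_max ltxx. Qed.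

Lemma relu_npos x : x <= 0 -> relu x = 0.
Proof. by move=> x0; apply/max_idPl. Qed.

Lemma relu_nneg x : 0 <= x -> relu x = x.
Proof. by move=> x0; apply/max_idPr. Qed.

Lemma reluBN x : relu x - relu (- x) = x.
Proof.
case: (leP 0 x) => x0; first by rewrite relu_nneg // relu_npos; lra.
by rewrite relu_npos ?ltW // relu_nneg; lra.
Qed.

Lemma reluDN x : relu x + relu (- x) = `|x|.
Proof.
case: (leP 0 x) => x0; first by rewrite relu_nneg // relu_npos ?ger0_norm; lra.
by rewrite relu_npos ?ltW // relu_nneg ?ltr0_norm; lra.
Qed.

Lemma min_relu x y : Num.min x y = x - relu (x - y).
Proof.
by case: (leP x y) => xy; [rewrite relu_npos | rewrite relu_nneg]; lra.
Qed.

End Relu.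

(** [HiddenLayer] extends a network at its input, whereas [relu_computable] unfolds from the output;
    this bridges the two. *)
Lemma append_layer (R : realType) (n h m k : nat)
    (N : relu_network R n h m) (W : 'M[R]_(k, n)) (b : 'cV[R]_k) :
  exists N' : relu_network R k h.+1 m,
    forall x, network_map N' x = W *m map_mx (@relu R) (network_map N x) + b.
Proof.
elim: N => {h m} [m V c | h m l V c N [N' N'E]].
  by exists (HiddenLayer V c (OutputLayer W b)).
by exists (HiddenLayer V c N') => x /=; rewrite N'E.
Qed.

Lemma dependent_choice (X : Type) (Y : X -> Type) (P : forall x, Y x -> Prop) :
  (forall x, exists y, P x y) -> exists f : forall x, Y x, forall x, P x (f x).
Proof. by move=> H; exists (fun x => sval (cid (H x))) => x; apply: svalP. Qed.

(** * Scalar functions computed with [h] hidden layers *)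

Section Computable.
Variables (R : realType) (m : nat).
Implicit Types (h : nat) (g : 'cV[R]_m -> R).

(** Units are indexed by any finite type, so that adding two functions is a disjoint union of their
    units. *)
Fixpoint relu_computable h g : Prop :=
  if h is h'.+1 then
    exists (I : finType) (a : I -> R) (G : I -> 'cV[R]_m -> R) (c : R),
      (forall i, relu_computable h' (G i)) /\
      (forall x, g x = \sum_i a i * relu (G i x) + c)
  else exists (w : 'rV[R]_m) (c : R), forall x, g x = (w *m x) 0 0 + c.

(** The coordinates run in parallel: the last hidden units of all of them, indexed by the dependent
    sum [T], form a single layer, whose inputs one network computes by induction. *)
Lemma relu_computable_network h n (F : 'I_n -> 'cV[R]_m -> R) :
  (forall i, relu_computable h (F i)) ->
  exists N : relu_network R n h m, forall x, network_map N x = \col_i F i x.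
Proof.
elim: h => [|h IHh] in n F *.
  move=> /choice[w] /choice[c] FE.
  exists (OutputLayer (\matrix_(i, j) w i 0 j) (\col_i c i)).
  move=> x; apply/colP => i; rewrite !mxE FE [in RHS]mxE; congr (_ + _).
  by apply: eq_bigr => j _; rewrite mxE.
move=> /= /(dependent_choice (Y := fun=> finType))[J].
move=> /(dependent_choice (Y := fun i => J i -> R))[a].
move=> /(dependent_choice (Y := fun i => J i -> 'cV[R]_m -> R))[G] /choice[c] FE.
pose T : finType := {i : 'I_n & J i}.
have hG (k : 'I_#|T|) :
    relu_computable h (G (tag (enum_val k)) (tagged (enum_val k))).
  exact: (FE _).1.
have [N NE] := IHh _ _ hG.
(* Block weights: output [i] reads only the units of its own block. *)
pose A i (t : T) := if tag t == i then a (tag t) (tagged t) else 0.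
have [N' N'E] := append_layer N
  (\matrix_(i < n, j < #|T|) A i (enum_val j)) (\col_i c i).
exists N' => x; apply/colP => i; rewrite N'E !mxE (FE i).2; congr (_ + _).
rewrite (reindex enum_rank) /=; last by apply: onW_bij; exact: enum_rank_bij.
under eq_bigr do rewrite !mxE NE mxE !enum_rankK.
rewrite -(sig_big_dep xpredT (fun _ => xpredT)
  (fun k l => (if k == i then a k l else 0) * relu (G k l x))) /=.
rewrite (bigD1 i) //= [X in _ + X]big1 ?addr0 => [|k /negPf ki].
  by apply: eq_bigr => l _; rewrite eqxx.
by rewrite big1 // => l _; rewrite ki mul0r.
Qed.

Lemma relu_computable_cst h (c : R) : relu_computable h (fun=> c).
Proof.
case: h => [|h] /=; first by exists 0, c => x; rewrite mul0mx mxE add0r.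
exists void, (fun=> 0), (fun _ _ => 0), c.
by split=> [|x]; [case | rewrite big_pred0 ?add0r //; case].
Qed.

Lemma relu_computableZ h g (k : R) :
  relu_computable h g -> relu_computable h (fun x => k * g x).
Proof.
case: h => [[w [c gE]] | h [I [a [G [c [hG gE]]]]]] /=.
  by exists (k *: w), (k * c) => x; rewrite gE -scalemxAl [in RHS]mxE mulrDr.
exists I, (fun i => k * a i), G, (k * c); split=> // x.
by rewrite gE mulrDr mulr_sumr; congr (_ + _); apply: eq_bigr => i _; rewrite mulrA.
Qed.

Lemma relu_computableD h g1 g2 : relu_computable h g1 -> relu_computable h g2 ->
  relu_computable h (fun x => g1 x + g2 x).
Proof.
case: h => [[w1 [c1 g1E]] [w2 [c2 g2E]] | h].
  by exists (w1 + w2), (c1 + c2) => x; rewrite g1E g2E mulmxDl [in RHS]mxE addrACA.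
move=> [I1 [a1 [G1 [c1 [hG1 g1E]]]]] [I2 [a2 [G2 [c2 [hG2 g2E]]]]].
exists (I1 + I2)%type, (fun i => match i with inl i => a1 i | inr i => a2 i end),
  (fun i => match i with inl i => G1 i | inr i => G2 i end), (c1 + c2).
by split=> [[]//|x]; rewrite big_sumType /= g1E g2E addrACA.
Qed.

Lemma relu_computableN h g : relu_computable h g -> relu_computable h (fun x => - g x).
Proof.
by move=> /(relu_computableZ (-1)); congr relu_computable; apply/funext => x; rewrite mulN1r.
Qed.

Lemma relu_computableB h g1 g2 : relu_computable h g1 -> relu_computable h g2 ->
  relu_computable h (fun x => g1 x - g2 x).
Proof. by move=> hg1 /relu_computableN; exact: relu_computableD. Qed.

Lemma relu_computable_relu h g :
  relu_computable h g -> relu_computable h.+1 (fun x => relu (g x)).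
Proof.
move=> hg; exists unit, (fun=> 1), (fun=> g), 0; split=> // x.
by rewrite (big_pred1 tt) ?mul1r ?addr0 //; case.
Qed.

Lemma relu_computableS h g : relu_computable h g -> relu_computable h.+1 g.
Proof.
move=> hg; have -> : g = (fun x => relu (g x) - relu (- g x)).
  by apply/funext => x; rewrite reluBN.
by apply: relu_computableB; apply: relu_computable_relu => //; exact: relu_computableN.
Qed.

Lemma relu_computableW h k g :
  (h <= k)%N -> relu_computable h g -> relu_computable k g.
Proof.
by move=> /subnK <- hg; elim: (k - h)%N => // l; exact: relu_computableS.
Qed.

Lemma relu_computable_norm h g :
  relu_computable h g -> relu_computable h.+1 (fun x => `|g x|).
Proof.
move=> hg; under eq_fun do rewrite -reluDN.
by apply: relu_computableD; apply: relu_computable_relu => //; exact: relu_computableN.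
Qed.

Lemma relu_computable_min h g1 g2 : relu_computable h g1 -> relu_computable h g2 ->
  relu_computable h.+1 (fun x => Num.min (g1 x) (g2 x)).
Proof.
move=> hg1 hg2; under eq_fun do rewrite min_relu.
apply: relu_computableB; first exact: relu_computableS.
by apply: relu_computable_relu; exact: relu_computableB.
Qed.

End Computable.

Lemma min_argmaxE (R : realType) (n : nat) (Y : 'cV[R]_n) (i : 'I_n) :
  (forall k, Y k 0 <= Y i 0) -> (forall k : 'I_n, (k < i)%N -> Y k 0 < Y i 0) ->
  min_argmax Y = i.+1.
Proof.
move=> Yi Ylt; rewrite /min_argmax; congr _.+1.
set P := fun j => _.
have Pi : P i by apply/forallP.
have hasP : has P (enum 'I_n) by apply/hasP; exists i; rewrite ?mem_enum.
apply/eqP; rewrite eqn_leq; apply/andP; split.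
  rewrite leqNgt; apply/negP => /(before_find i).
  by rewrite nth_ord_enum Pi.
rewrite leqNgt; apply/negP => lt_i.
have := nth_find i hasP.
have -> : find P (enum 'I_n) = Ordinal (ltn_trans lt_i (ltn_ord i)) by [].
rewrite nth_ord_enum => /forallP/(_ i).
by rewrite leNgt Ylt.
Qed.

(** * Cost recursion for the ENO shift *)

Section Eno.
Variables (R : realType) (p : nat).
Implicit Type f : 'cV[R]_(2 * p - 2).

Definition eno_gap f (j r : nat) : R :=
  `|undivided_difference f j (p - 1 - r)| - `|undivided_difference f j (p - 2 - r)|.

(** [eno_cost f k r] is the cost of being in state [r] after [k] steps.  Starting
    in state [r] costs [r], so that the start [0] is the only free one. *)
Fixpoint eno_cost f (k r : nat) : R :=
  if k is k'.+1 then
    let stay := eno_cost f k' r + relu (eno_gap f k'.+2 r) in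
    if r is r'.+1 then
      Num.min stay (eno_cost f k' r' + relu (- eno_gap f k'.+2 r'))
    else stay
  else r%:R.

(** The algorithm numbers its steps from 2, so the one following [k] steps is [j = k.+2]. *)
Definition eno_state f (k : nat) : nat := foldl (eno_step f) 0%N (iota 2 k).

Lemma eno_stateS f k :
  eno_state f k.+1 =
    if 0 < eno_gap f k.+2 (eno_state f k) then (eno_state f k).+1 else eno_state f k.
Proof.
have -> : eno_state f k.+1 = eno_step f (eno_state f k) k.+2.
  by rewrite /eno_state -[k.+1]addn1 iotaD foldl_cat addn1.
by rewrite /eno_step subr_gt0.
Qed.

Lemma eno_state_le f k : (eno_state f k <= k)%N.
Proof. by elim: k => // k IHk; rewrite eno_stateS; case: ifP => _ //; exact: leqW. Qed.

Lemma eno_cost_ge0 f k r : 0 <= eno_cost f k r.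
Proof.
elim: k r => [|k IHk] r; first exact: ler0n.
case: r => [|r] /=; first by rewrite addr_ge0 ?relu_ge0.
by rewrite le_min !addr_ge0 ?relu_ge0.
Qed.

Lemma eno_cost_state f k : eno_cost f k (eno_state f k) = 0.
Proof.
elim: k => // k IHk; rewrite eno_stateS; apply/eqP; rewrite eq_le eno_cost_ge0 andbT.
case: ltP => d /=.
  by rewrite ge_min IHk (relu_npos (x := - _)) ?addr0 ?lexx ?orbT ?oppr_le0 ?ltW.
(* Without a move up, staying is free, and it bounds the cost from above whether or not the state is
   0. *)
have : eno_cost f k (eno_state f k) + relu (eno_gap f k.+2 (eno_state f k)) <= 0.
  by rewrite IHk relu_npos ?addr0.
by case: (eno_state f k) => // r; rewrite ge_min => ->.
Qed.

Lemma eno_cost_gt0 f k r : (r < eno_state f k)%N -> 0 < eno_cost f k r.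
Proof.
elim: k r => // k IHk r; rewrite eno_stateS => r_lt.
(* Either [r] was already below the old state, or it equals it and the algorithm moved up, so that
   the gap penalizes staying. *)
have stay_gt0 : 0 < eno_cost f k r + relu (eno_gap f k.+2 r).
  case: (ltnP r (eno_state f k)) => [/IHk c_gt0|r_ge].
    by rewrite ltr_pwDl ?relu_ge0.
  move: r_lt; case: ifP => [d r_le|_]; last by rewrite ltnNge r_ge.
  have -> : r = eno_state f k by apply/eqP; rewrite eqn_leq r_ge andbT -ltnS.
  by rewrite ltr_wpDl ?eno_cost_ge0 ?relu_gt0.
case: r r_lt stay_gt0 => //= r r_lt stay_gt0; rewrite lt_min stay_gt0 /=.
(* Arrival from [r]: the state grows by at most one, so [r] lay below the old state. *)
rewrite ltr_pwDl ?relu_ge0 // IHk //; move: r_lt.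
by case: ifP => _ //; exact: ltnW.
Qed.

Lemma relu_computable_undivided_difference j l :
  relu_computable 0 (fun f => undivided_difference f j l).
Proof.
elim: j l => [|j IHj] l; last exact: relu_computableB.
rewrite /undivided_difference; case: insubP => [i _ _|_] /=.
  by exists (delta_mx 0 i), 0 => f; rewrite -rowE mxE addr0.
(* Out of range, the entry is the default constant 0. *)
exact: (relu_computable_cst _ 0 0).
Qed.

Lemma relu_computable_gap j r : relu_computable 1 (fun f => eno_gap f j r).
Proof.
by apply: relu_computableB; apply: relu_computable_norm;
   exact: relu_computable_undivided_difference.
Qed.

(** The offset 2 is the depth of the penalties: one layer for the absolute values, one for the ReLU.
    Each minimum then adds a layer. *)
Lemma relu_computable_cost k r : relu_computable k.+2 (fun f => eno_cost f k r).
Proof.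
elim: k r => [|k IHk] r; first exact: relu_computable_cst.
have stay : relu_computable k.+2 (fun f => eno_cost f k r + relu (eno_gap f k.+2 r)).
  apply: relu_computableD => //; apply: (@relu_computableW _ _ 2) => //.
  by apply: relu_computable_relu; exact: relu_computable_gap.
case: r stay => [|r] stay; first exact: relu_computableS.
apply: relu_computable_min => //; apply: relu_computableD => //.
apply: (@relu_computableW _ _ 2) => //; apply: relu_computable_relu.
by apply: relu_computableN; exact: relu_computable_gap.
Qed.

End Eno.

Theorem theorem4p1 (R : realType) (p : nat) (hp : (2 <= p)%N) :
  exists N : relu_network R (p - 1)
               (p + up_log 2 'C(p - 2, (p - 2)./2)) (2 * p - 2),
    forall f : 'cV[R]_(2 * p - 2),
      (min_argmax (network_map N f) - 1)%N = eno_stencil_shift f.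
Proof.
have [|N NE] := @relu_computable_network R (2 * p - 2)
    (p + up_log 2 'C(p - 2, (p - 2)./2)) (p - 1) (fun i f => - eno_cost f (p - 2) i).
  move=> i; apply: relu_computableN; apply: relu_computableW (@relu_computable_cost R p _ i).
  (* The final costs have depth [(p - 2).+2 = p]; padding supplies the logarithmic summand. *)
  by rewrite -addn2 subnK // leq_addr.
exists N => f; rewrite NE /eno_stencil_shift /index_iota -/(eno_state f (p - 2)).
have state_lt : (eno_state f (p - 2) < p - 1)%N.
  by apply: leq_ltn_trans (eno_state_le _ _) _; rewrite ltn_sub2l.
rewrite (min_argmaxE (i := Ordinal state_lt)) ?subn1 // => k; rewrite !mxE /= eno_cost_state.
  by rewrite lerN2 eno_cost_ge0.
by move=> /eno_cost_gt0; rewrite ltrN2.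
Qed.
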